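(* Let $S$ be a restriction semigroup. The functors $\widehat{U}\colon\widehat{\mathcal{A}}(S)\to\mathcal{P}(S)$ and $\widehat{G}\colon\mathcal{P}(S)\to\widehat{\mathcal{A}}(S)$ establish an equivalence between the categories $\widehat{\mathcal{A}}(S)$ and $\mathcal{P}(S)$.
   Context: A restriction semigroup is an algebra $(S;\cdot,{}^*,{}^+)$ of type $(2,1,1)$ such that $(S;\cdot)$ is a semigroup and the following identities hold: $x^+x=x$, $x^+y^+=y^+x^+$, $(x^+y)^+=x^+y^+$, $(xy)^+x=xy^+$; $xx^*=x$, $x^*y^*=y^*x^*$, $(xy^* )^*=x^*y^*$, $y(xy)^*=x^*y$; $(x^+)^*=x^+$, $(x^* )^+=x^*$. Morphisms preserve all three operations. $P(S)=\{s^*\colon s\in S\}=\{s^+\colon s\in S\}$ is the semilattice of projections. The natural partial order is: $s\le t$ iff $s=et$ for some $e\in P(S)$. Elements $s,t$ are compatible, $s\sim t$, if $st^*=ts^*$ and $t^+s=s^+t$. A morphism $\psi\colon T\to S$ is proper if it is surjective and $\psi(u)=\psi(v)$ implies $u\sim v$ for all $u,v\in T$. Inverse semigroups are restriction semigroups via $s^*=s^{-1}s$, $s^+=ss^{-1}$. $\mathcal{I}(X)$ is the symmetric inverse semigroup of all partial bijections of $X$, composed from right to left. For a subset $B$ of a poset, $B^\downarrow$ is the set of elements lying below some element of $B$, and $b^\downarrow=\{b\}^\downarrow$. A premorphism $\varphi\colon S\to T$ between restriction semigroups is a map with $\varphi(s)\varphi(t)\le\varphi(st)$, $\varphi(s)^*\le\varphi(s^*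 )$ and $\varphi(s)^+\le\varphi(s^+)$ for all $s,t\in S$. For $T=\mathcal{I}(X)$ we write $\varphi_s$ for $\varphi(s)$. The category $\mathcal{A}(S)$: objects are triples $(\alpha,p,X)$ where $X$ is a semilattice, $p\colon X\to P(S)$ is a semilattice morphism and $\alpha\colon S\to\mathcal{I}(X)$ is a premorphism such that: (A1) for all $s\in S$, $\operatorname{dom}\alpha_s$ and $\operatorname{ran}\alpha_s$ are order ideals of $X$; (A2) for all $s\in S$, $\alpha_s$ is an order isomorphism (from its domain onto its range); (A3) for all $e\in P(S)$, $(p^{-1}(e))^\downarrow\subseteq\operatorname{dom}\alpha_e\subseteq p^{-1}(e^\downarrow)$; (A4) for all $s\in S$, $\operatorname{dom}\alpha_s\cap p^{-1}(s^* )\ne\varnothing$. A morphism from $(\alpha,p_\alpha,X)$ to $(\beta,p_\beta,Y)$ is a semilattice morphism $f\colon X\to Y$ such that (M1) $p_\alpha=p_\beta f$; (M2) $f(\operatorname{dom}\alpha_s)\subseteq\operatorname{dom}\beta_s$ and $\beta_s(f(e))=f(\alpha_s(e))$ for all $s\in S$ and $e\in\operatorname{dom}\alpha_s$. $\widehat{\mathcal{A}}(S)$ is the full subcategory of $\mathcal{A}(S)$ whose objects satisfy (A3a): for all $s\in S$, $\operatorname{dom}\alpha_s=\{y\in X\colon y\in\operatorname{dom}\alpha_t\cap p^{-1}(t^* )\text{ for some }t\le s\}$. $\widehat I\colon\widehat{\mathcal{A}}(S)\to\mathcal{A}(S)$ is the inclusion functor. The category $\mathcal{P}(S)$: objects are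 proper morphisms $\psi\colon T\to S$ with $T$ a restriction semigroup; a morphism from $\psi_1\colon T_1\to S$ to $\psi_2\colon T_2\to S$ is a morphism of restriction semigroups $\gamma\colon T_1\to T_2$ with $\psi_2\gamma=\psi_1$. For an object $(\alpha,p,X)$ of $\mathcal{A}(S)$, the partial action product $X\rtimes^p_\alpha S$ is the restriction semigroup on the set $\{(x,s)\in X\times S\colon x\in\operatorname{ran}\alpha_s,\ p(x)=s^+\}$ with $(x,s)(y,t)=(\alpha_s(\alpha_s^{-1}(x)\wedge y),st)$, $(x,s)^*=(\alpha_s^{-1}(x),s^* )$, $(x,s)^+=(x,s^+)$. The functor $U\colon\mathcal{A}(S)\to\mathcal{P}(S)$ sends $(\alpha,p,X)$ to the proper morphism $X\rtimes^p_\alpha S\to S$, $(x,s)\mapsto s$, and a morphism $f\colon X\to Y$ to the map $(x,s)\mapsto(f(x),s)$. Put $\widehat U=U\widehat I$. The functor $\widehat G\colon\mathcal{P}(S)\to\widehat{\mathcal{A}}(S)$ sends $\psi\colon T\to S$ to $(\widehat\psi,\psi|_{P(T)},P(T))$, where $\widehat\psi\colon S\to\mathcal{I}(P(T))$ is given by $\operatorname{dom}\widehat\psi_s=\{e\in P(T)\colon e\le t^*\text{ for some }t\in T\text{ with }\psi(t)\le s\}$ and $\widehat\psi_s(e)=(te)^+$ for any $t\in T$ with $e\le t^*$, $\psi(t)\le s$ (this is well defined); and it sends $\gamma\colon T_1\to T_2$ to $\gamma|_{P(T_1)}\colon P(T_1)\to P(T_2)$. *)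

(* Defs.v *)
(* Every structure lives on an arbitrary carrier in Type, with Leibniz equality.
   The axioms are used as follows: extensionality and proof irrelevance compare
   partial bijections, elements of subtypes and morphisms; indefinite
   description evaluates a partial bijection at a point of its domain. *)
From Stdlib Require Import ssreflect ssrbool FunctionalExtensionality
  PropExtensionality ProofIrrelevance IndefiniteDescription.

Set Implicit Arguments.
Unset Strict Implicit.
Unset Printing Implicit Defensive.
Set SsrOldRewriteGoalsOrder.

(* The carrier is allowed to be empty. *)
Record restriction_semigroup := RestrictionSemigroup {
  rs_car :> Type;
  rs_mul : rs_car -> rs_car -> rs_car;
  rs_star : rs_car -> rs_car;
  rs_plus : rs_car -> rs_car;
  rs_mulA : forall x y z, rs_mul x (rs_mul y z) = rs_mul (rs_mul x y) z;
  rs_plus_mul : forall x, rs_mul (rs_plus x) x = x;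
  rs_plusC : forall x y,
    rs_mul (rs_plus x) (rs_plus y) = rs_mul (rs_plus y) (rs_plus x);
  rs_plusM : forall x y,
    rs_plus (rs_mul (rs_plus x) y) = rs_mul (rs_plus x) (rs_plus y);
  rs_plus_ample : forall x y,
    rs_mul (rs_plus (rs_mul x y)) x = rs_mul x (rs_plus y);
  rs_mul_star : forall x, rs_mul x (rs_star x) = x;
  rs_starC : forall x y,
    rs_mul (rs_star x) (rs_star y) = rs_mul (rs_star y) (rs_star x);
  rs_starM : forall x y,
    rs_star (rs_mul x (rs_star y)) = rs_mul (rs_star x) (rs_star y);
  rs_star_ample : forall x y,
    rs_mul y (rs_star (rs_mul x y)) = rs_mul (rs_star x) y;
  rs_star_plus : forall x, rs_star (rs_plus x) = rs_plus x;
  rs_plus_star : forall x, rs_plus (rs_star x) = rs_star x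
}.

Declare Scope rs_scope.
Delimit Scope rs_scope with rs.
Local Open Scope rs_scope.

Notation "x * y" := (rs_mul x y) : rs_scope.
Notation "x ^*" := (rs_star x) (at level 2, left associativity, format "x ^*")
  : rs_scope.
Notation "x ^+" := (rs_plus x) (at level 2, left associativity, format "x ^+")
  : rs_scope.

Definition is_projection (S : restriction_semigroup) (e : S) : Prop :=
  exists s : S, e = s^*.

Definition rs_le (S : restriction_semigroup) (s t : S) : Prop :=
  exists2 e : S, is_projection e & s = e * t.

Definition compatible (S : restriction_semigroup) (s t : S) : Prop :=
  s * t^* = t * s^* /\ t^+ * s = s^+ * t.

Record rs_morphism (S T : restriction_semigroup) := RsMorphism {
  rs_fun :> S -> T;
  rs_funM : forall s t, rs_fun (s * t) = rs_fun s * rs_fun t;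
  rs_fun_star : forall s, rs_fun s^* = (rs_fun s)^*;
  rs_fun_plus : forall s, rs_fun s^+ = (rs_fun s)^+
}.

Definition proper (T S : restriction_semigroup) (psi : rs_morphism T S) : Prop :=
  (forall s, exists t, psi t = s) /\
  (forall u v, psi u = psi v -> compatible u v).

Record premorphism (S T : restriction_semigroup) := Premorphism {
  pre_fun :> S -> T;
  pre_funM : forall s t, rs_le (pre_fun s * pre_fun t) (pre_fun (s * t));
  pre_fun_star : forall s, rs_le (pre_fun s)^* (pre_fun s^*);
  pre_fun_plus : forall s, rs_le (pre_fun s)^+ (pre_fun s^+)
}.

Section RsTheory.
Context (S : restriction_semigroup).
Implicit Types s t u e f : S.

Lemma is_projection_star s : is_projection s^*.
Proof. by exists s. Qed.

Lemma is_projection_plus s : is_projection s^+.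
Proof. by exists s^+; rewrite rs_star_plus. Qed.

Lemma is_projectionP e : is_projection e <-> exists s, e = s^+.
Proof.
split; first by case=> s ->; exists s^*; rewrite rs_plus_star.
by case=> s ->; apply: is_projection_plus.
Qed.

Lemma projS e : is_projection e -> e^* = e.
Proof. by case=> s ->; rewrite -{1}(rs_plus_star s) rs_star_plus rs_plus_star. Qed.

Lemma projP e : is_projection e -> e^+ = e.
Proof. by case=> s ->; rewrite rs_plus_star. Qed.

Lemma projC e f : is_projection e -> is_projection f -> e * f = f * e.
Proof. by case=> s -> [t ->]; apply: rs_starC. Qed.

Lemma projI e : is_projection e -> e * e = e.
Proof. by move=> he; rewrite -{2}(projS he) rs_mul_star. Qed.

Lemma projM e f : is_projection e -> is_projection f -> is_projection (e * f).
Proof. by case=> s -> [t ->]; exists (s * t^*); rewrite rs_starM. Qed.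

Lemma plus_mul_plus s t : (s * t^+)^+ = (s * t)^+.
Proof.
rewrite -rs_plus_ample rs_plusM rs_plusC -rs_plusM.
by rewrite rs_mulA rs_plus_mul.
Qed.

Lemma star_mul_star s t : (s^* * t)^* = (s * t)^*.
Proof.
rewrite -rs_star_ample rs_starM rs_starC -rs_starM.
by rewrite -rs_mulA rs_mul_star.
Qed.

Lemma plus_projM e s : is_projection e -> (e * s)^+ = e * s^+.
Proof. by move=> he; rewrite -{1}(projP he) rs_plusM (projP he). Qed.

Lemma star_projM s f : is_projection f -> (s * f)^* = s^* * f.
Proof. by move=> hf; rewrite -{1}(projS hf) rs_starM (projS hf). Qed.

Lemma mul_proj s f : is_projection f -> s * f = (s * f)^+ * s.
Proof. by move=> hf; rewrite rs_plus_ample projP. Qed.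

Lemma proj_mul e s : is_projection e -> e * s = s * (e * s)^*.
Proof. by move=> he; rewrite rs_star_ample projS. Qed.

Lemma rs_le_plus s t : rs_le s t <-> s = s^+ * t.
Proof.
split; last by move=> ->; exists s^+ => //; apply: is_projection_plus.
by case=> e he ->; rewrite plus_projM // -rs_mulA rs_plus_mul.
Qed.

Lemma rs_le_star s t : rs_le s t <-> s = t * s^*.
Proof.
split; first by case=> e he ->; rewrite -proj_mul.
move=> ->; rewrite mul_proj; last exact: is_projection_star.
by exists (t * s^*)^+ => //; apply: is_projection_plus.
Qed.

Lemma rs_le_refl s : rs_le s s.
Proof. by apply/rs_le_plus; rewrite rs_plus_mul. Qed.

Lemma rs_le_trans t s u : rs_le s t -> rs_le t u -> rs_le s u.
Proof.
case=> e he -> [f hf ->]; exists (e * f); first exact: projM.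
by rewrite rs_mulA.
Qed.

Lemma rs_leM s t u v : rs_le s t -> rs_le u v -> rs_le (s * u) (t * v).
Proof.
move=> /rs_le_plus hs [e he ->].
exists (s^+ * (t * e)^+).
  by apply: projM; apply: is_projection_plus.
rewrite {1}hs -!rs_mulA; congr (_ * _).
by rewrite !rs_mulA; congr (_ * _); rewrite -mul_proj.
Qed.

Lemma rs_le_starM s t : rs_le s t -> rs_le s^* t^*.
Proof.
move=> /rs_le_star ->; rewrite rs_starM rs_starC.
by exists s^* => //; apply: is_projection_star.
Qed.

Lemma rs_le_plusM s t : rs_le s t -> rs_le s^+ t^+.
Proof.
move=> /rs_le_plus ->; rewrite rs_plusM.
by exists s^+ => //; apply: is_projection_plus.
Qed.

Lemma rs_le_proj s e : is_projection e -> rs_le s e -> is_projection s.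
Proof. by move=> he [f hf ->]; apply: projM. Qed.

Lemma rs_le_mulr s e : is_projection e -> rs_le (s * e) s.
Proof.
by move=> he; rewrite mul_proj //; exists (s * e)^+ => //; apply: is_projection_plus.
Qed.

Lemma rs_le_mull s e : is_projection e -> rs_le (e * s) s.
Proof. by move=> he; exists e. Qed.

End RsTheory.

Lemma rs_fun_le (S T : restriction_semigroup) (f : rs_morphism S T) (s t : S) :
  rs_le s t -> rs_le (f s) (f t).
Proof.
case=> e [u ->] ->; exists (f u)^*; first exact: is_projection_star.
by rewrite rs_funM rs_fun_star.
Qed.

(* Idempotent commutative semigroups, the order being derived from the meet.
   MathComp's meetSemilatticeType is not used because it would make a choice
   structure part of the data of each object of the categories below. *)
Record semilattice := Semilattice {
  sl_car :> Type;
  meet : sl_car -> sl_car -> sl_car;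
  meetA : forall x y z, meet x (meet y z) = meet (meet x y) z;
  meetC : forall x y, meet x y = meet y x;
  meetI : forall x, meet x x = x
}.

Definition sl_le (X : semilattice) (x y : X) : Prop := x = meet x y.

Record sl_morphism (X Y : semilattice) := SlMorphism {
  sl_fun :> X -> Y;
  sl_funM : forall x y, sl_fun (meet x y) = meet (sl_fun x) (sl_fun y)
}.

Definition order_ideal (X : semilattice) (A : X -> Prop) : Prop :=
  forall x y, A y -> sl_le x y -> A x.

Definition down (X : semilattice) (B : X -> Prop) : X -> Prop :=
  fun x => exists2 b, B b & sl_le x b.

Section SlTheory.
Context (X : semilattice).
Implicit Types x y z : X.

Lemma sl_le_refl x : sl_le x x.
Proof. by rewrite /sl_le meetI. Qed.

Lemma sl_le_trans y x z : sl_le x y -> sl_le y z -> sl_le x z.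
Proof. by rewrite /sl_le => h1 h2; rewrite {1}h1 h2 meetA -h1. Qed.

Lemma sl_le_anti x y : sl_le x y -> sl_le y x -> x = y.
Proof. by rewrite /sl_le => h1 h2; rewrite h1 meetC -h2. Qed.

Lemma meet_lel x y : sl_le (meet x y) x.
Proof. by rewrite /sl_le (meetC _ x) meetA meetI. Qed.

Lemma meet_ler x y : sl_le (meet x y) y.
Proof. by rewrite /sl_le -meetA meetI. Qed.

Lemma le_meet x y z : sl_le z x -> sl_le z y -> sl_le z (meet x y).
Proof. by rewrite /sl_le => h1 h2; rewrite meetA -h1. Qed.

End SlTheory.

Lemma sl_fun_le (X Y : semilattice) (f : sl_morphism X Y) (x y : X) :
  sl_le x y -> sl_le (f x) (f y).
Proof. by rewrite /sl_le => h; rewrite {1}h sl_funM. Qed.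

Record projection (S : restriction_semigroup) := Projection {
  pval : S;
  pvalP : is_projection pval
}.

Lemma pval_inj (S : restriction_semigroup) (e f : projection S) :
  pval e = pval f -> e = f.
Proof.
case: e f => e he [f hf] /= ef; subst f.
by rewrite (proof_irrelevance _ he hf).
Qed.

Lemma proj_meetA (S : restriction_semigroup) (e f g : projection S) :
  Projection (projM (pvalP e) (pvalP (Projection (projM (pvalP f) (pvalP g)))))
  = Projection (projM (pvalP (Projection (projM (pvalP e) (pvalP f)))) (pvalP g)).
Proof. by apply: pval_inj; rewrite /= rs_mulA. Qed.

Lemma proj_meetC (S : restriction_semigroup) (e f : projection S) :
  Projection (projM (pvalP e) (pvalP f)) = Projection (projM (pvalP f) (pvalP e)).
Proof. by apply: pval_inj; rewrite /= projC //; apply: pvalP. Qed.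

Lemma proj_meetI (S : restriction_semigroup) (e : projection S) :
  Projection (projM (pvalP e) (pvalP e)) = e.
Proof. by apply: pval_inj; rewrite /= projI //; apply: pvalP. Qed.

Definition projections (S : restriction_semigroup) : semilattice :=
  @Semilattice (projection S)
    (fun e f => Projection (projM (pvalP e) (pvalP f)))
    (@proj_meetA S) (@proj_meetC S) (@proj_meetI S).

Definition pstar (S : restriction_semigroup) (s : S) : projections S :=
  Projection (is_projection_star s).

Definition pplus (S : restriction_semigroup) (s : S) : projections S :=
  Projection (is_projection_plus s).

Lemma sl_le_pval (S : restriction_semigroup) (e f : projections S) :
  sl_le e f <-> rs_le (pval e) (pval f).
Proof.
have he := pvalP e; have hf := pvalP f.
split; first by move/(f_equal (@pval S)) => /= {1}->; exists (pval e).
by move/rs_le_plus => h; apply: pval_inj; rewrite /= {1}h projP.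
Qed.

Lemma is_projection_fun (S T : restriction_semigroup) (f : rs_morphism S T)
  (e : S) : is_projection e -> is_projection (f e).
Proof. by case=> s ->; exists (f s); rewrite rs_fun_star. Qed.

Lemma restr_funM (S T : restriction_semigroup) (f : rs_morphism S T)
  (e g : projections S) :
  Projection (is_projection_fun f (pvalP (meet e g))) =
  meet (Projection (is_projection_fun f (pvalP e)) : projections T)
       (Projection (is_projection_fun f (pvalP g))).
Proof. by apply: pval_inj; rewrite /= rs_funM. Qed.

Definition restrP (S T : restriction_semigroup) (f : rs_morphism S T) :
    sl_morphism (projections S) (projections T) :=
  @SlMorphism (projections S) (projections T)
    (fun e => Projection (is_projection_fun f (pvalP e)))
    (@restr_funM S T f).

(* [graph a x y] reads: [a] is defined at [x], with value [y]. *)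
Record pbij (X : Type) := PBij {
  graph : X -> X -> Prop;
  graph_fun : forall x y z, graph x y -> graph x z -> y = z;
  graph_inj : forall x y z, graph x z -> graph y z -> x = y
}.

Definition dom (X : Type) (a : pbij X) (x : X) : Prop := exists y, graph a x y.
Definition ran (X : Type) (a : pbij X) (y : X) : Prop := exists x, graph a x y.

Lemma pbij_eq (X : Type) (a b : pbij X) :
  (forall x y, graph a x y <-> graph b x y) -> a = b.
Proof.
case: a b => [a fa ia] [b fb ib] /= h.
have ab : a = b.
  apply: functional_extensionality => x; apply: functional_extensionality => y.
  exact: propositional_extensionality.
by subst b; rewrite (proof_irrelevance _ fa fb) (proof_irrelevance _ ia ib).
Qed.

Definition pb_inv (X : Type) (a : pbij X) : pbij X :=
  @PBij X (fun x y => graph a y x)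
    (fun x y z hy hz => graph_inj hy hz) (fun x y z hx hy => graph_fun hx hy).

Definition comp_graph (X : Type) (a b : pbij X) (x z : X) : Prop :=
  exists2 y, graph b x y & graph a y z.

Lemma comp_fun (X : Type) (a b : pbij X) x y z :
  comp_graph a b x y -> comp_graph a b x z -> y = z.
Proof.
move=> [u xu uy] [v xv vz]; move: (graph_fun xu xv) => uv; subst v.
exact: graph_fun uy vz.
Qed.

Lemma comp_inj (X : Type) (a b : pbij X) x y z :
  comp_graph a b x z -> comp_graph a b y z -> x = y.
Proof.
move=> [u xu uz] [v yv vz]; move: (graph_inj uz vz) => uv; subst v.
exact: graph_inj xu yv.
Qed.

(* Composition from right to left: [b] first, then [a]. *)
Definition pb_comp (X : Type) (a b : pbij X) : pbij X :=
  PBij (@comp_fun X a b) (@comp_inj X a b).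

Definition pb_star (X : Type) (a : pbij X) : pbij X := pb_comp (pb_inv a) a.
Definition pb_plus (X : Type) (a : pbij X) : pbij X := pb_comp a (pb_inv a).

Section SymInv.
Context (X : Type).
Implicit Types a b c : pbij X.

Lemma pb_compE a b x z :
  graph (pb_comp a b) x z <-> exists2 y, graph b x y & graph a y z.
Proof. by []. Qed.

Lemma pb_starE a x y : graph (pb_star a) x y <-> x = y /\ dom a x.
Proof.
split; first by case=> z xz /= yz; split; [exact: graph_inj xz yz | exists z].
by case=> <- [z xz]; exists z.
Qed.

Lemma pb_plusE a x y : graph (pb_plus a) x y <-> x = y /\ ran a x.
Proof.
split; first by case=> z /= zx zy; split; [exact: graph_fun zx zy | exists z].
by case=> <- [z xz]; exists z.
Qed.

Lemma I_mulA a b c : pb_comp a (pb_comp b c) = pb_comp (pb_comp a b) c.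
Proof.
apply: pbij_eq => x y; split.
  by case=> z [w xw wz] zy; exists w => //; exists z.
by case=> w xw [z wz zy]; exists z => //; exists w.
Qed.

Lemma I_plus_mul a : pb_comp (pb_plus a) a = a.
Proof.
apply: pbij_eq => x y; split; first by case=> z xz /pb_plusE [<-].
by move=> xy; exists y => //; apply/pb_plusE; split => //; exists x.
Qed.

Lemma I_mul_star a : pb_comp a (pb_star a) = a.
Proof.
apply: pbij_eq => x y; split; first by case=> z /pb_starE [<-].
by move=> xy; exists x => //; apply/pb_starE; split => //; exists y.
Qed.

Lemma I_plusC a b : pb_comp (pb_plus a) (pb_plus b) = pb_comp (pb_plus b) (pb_plus a).
Proof.
by apply: pbij_eq => x y; split; case=> z /pb_plusE [<- h1] /pb_plusE [<- h2];
  exists x; apply/pb_plusE.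
Qed.

Lemma I_starC a b : pb_comp (pb_star a) (pb_star b) = pb_comp (pb_star b) (pb_star a).
Proof.
by apply: pbij_eq => x y; split; case=> z /pb_starE [<- h1] /pb_starE [<- h2];
  exists x; apply/pb_starE.
Qed.

Lemma I_plusM a b : pb_plus (pb_comp (pb_plus a) b) = pb_comp (pb_plus a) (pb_plus b).
Proof.
apply: pbij_eq => x y; split.
  case/pb_plusE=> <- [z [w zw /pb_plusE [e h]]]; subst w.
  by exists x; apply/pb_plusE; split => //; exists z.
case=> z /pb_plusE [<- [w wx]] /pb_plusE [<- h].
apply/pb_plusE; split => //; exists w; exists x => //.
exact/pb_plusE.
Qed.

Lemma I_starM a b : pb_star (pb_comp a (pb_star b)) = pb_comp (pb_star a) (pb_star b).
Proof.
apply: pbij_eq => x y; split.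
  case/pb_starE=> <- [z [w /pb_starE [e h] wz]]; subst w.
  by exists x; apply/pb_starE; split => //; exists z.
case=> z /pb_starE [<- h] /pb_starE [<- [w xw]].
apply/pb_starE; split => //; exists w; exists x => //.
exact/pb_starE.
Qed.

Lemma I_plus_ample a b : pb_comp (pb_plus (pb_comp a b)) a = pb_comp a (pb_plus b).
Proof.
apply: pbij_eq => x y; split.
  case=> z xz /pb_plusE [e [w [v wv vz]]]; subst z.
  move: (graph_inj xz vz) => e; subst v.
  by exists x => //; apply/pb_plusE; split => //; exists w.
case=> z /pb_plusE [<- [w wx]] xy; exists y => //; apply/pb_plusE.
by split => //; exists w; exists x.
Qed.

Lemma I_star_ample a b : pb_comp b (pb_star (pb_comp a b)) = pb_comp (pb_star a) b.
Proof.
apply: pbij_eq => x y; split.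
  case=> z /pb_starE [<- [w [v xv vw]]] xy.
  move: (graph_fun xy xv) => e; subst v.
  by exists y => //; apply/pb_starE; split => //; exists w.
case=> z xz /pb_starE [e [w zw]]; subst z; exists x => //; apply/pb_starE.
by split => //; exists w; exists y.
Qed.

Lemma I_star_plus a : pb_star (pb_plus a) = pb_plus a.
Proof.
apply: pbij_eq => x y; split; first by case/pb_starE=> <- [z /pb_plusE [_ h]]; apply/pb_plusE.
by case/pb_plusE=> <- h; apply/pb_starE; split => //; exists x; apply/pb_plusE.
Qed.

Lemma I_plus_star a : pb_plus (pb_star a) = pb_star a.
Proof.
apply: pbij_eq => x y; split; first by case/pb_plusE=> <- [z /pb_starE [-> h]]; apply/pb_starE.
by case/pb_starE=> <- h; apply/pb_plusE; split => //; exists x; apply/pb_starE.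
Qed.

End SymInv.

Definition sym_inv (X : Type) : restriction_semigroup :=
  @RestrictionSemigroup (pbij X) (@pb_comp X) (@pb_star X) (@pb_plus X)
    (@I_mulA X) (@I_plus_mul X) (@I_plusC X) (@I_plusM X) (@I_plus_ample X)
    (@I_mul_star X) (@I_starC X) (@I_starM X) (@I_star_ample X)
    (@I_star_plus X) (@I_plus_star X).

Lemma I_leP (X : Type) (a b : sym_inv X) :
  rs_le a b <-> forall x y, graph a x y -> graph b x y.
Proof.
split; first by case=> e [c ->] -> x y [z xz /pb_starE [<-]].
move=> h; apply/rs_le_star; apply: pbij_eq => x y; split.
  by move=> xy; exists x; [apply/pb_starE; split => //; exists y | apply: h].
case=> z /pb_starE [<- [w xw]] xy.
by rewrite (graph_fun xy (h _ _ xw)).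
Qed.

Definition pb_app (X : Type) (a : pbij X) (x : X) (h : dom a x) : X :=
  proj1_sig (constructive_indefinite_description _ h).

Lemma pb_appP (X : Type) (a : pbij X) (x : X) (h : dom a x) :
  graph a x (pb_app h).
Proof. exact: proj2_sig (constructive_indefinite_description _ h). Qed.

Record category := Category {
  Ob :> Type;
  Hom : Ob -> Ob -> Type;
  Id : forall a, Hom a a;
  Comp : forall a b c, Hom b c -> Hom a b -> Hom a c;
  Comp_idl : forall a b (f : Hom a b), Comp (Id b) f = f;
  Comp_idr : forall a b (f : Hom a b), Comp f (Id a) = f;
  CompA : forall a b c d (h : Hom c d) (g : Hom b c) (f : Hom a b),
    Comp h (Comp g f) = Comp (Comp h g) f
}.

Record functor (C D : category) := Functor {
  F_ob :> C -> D;
  F_hom : forall a b, Hom a b -> Hom (F_ob a) (F_ob b);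
  F_id : forall a, F_hom (Id a) = Id (F_ob a);
  F_comp : forall a b c (g : Hom b c) (f : Hom a b),
    F_hom (Comp g f) = Comp (F_hom g) (F_hom f)
}.

Definition functor_id (C : category) : functor C C :=
  @Functor C C (fun a => a) (fun a b f => f)
    (fun a => eq_refl) (fun a b c g f => eq_refl).

Lemma functor_comp_id (C D E : category) (G : functor D E) (F : functor C D) a :
  F_hom G (F_hom F (Id a)) = Id (G (F a)).
Proof. by rewrite !F_id. Qed.

Lemma functor_comp_comp (C D E : category) (G : functor D E) (F : functor C D)
  a b c (g : Hom b c) (f : Hom a b) :
  F_hom G (F_hom F (Comp g f)) =
  Comp (F_hom G (F_hom F g)) (F_hom G (F_hom F f)).
Proof. by rewrite !F_comp. Qed.

Definition functor_comp (C D E : category) (G : functor D E) (F : functor C D) :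
    functor C E :=
  @Functor C E (fun a => G (F a)) (fun a b f => F_hom G (F_hom F f))
    (functor_comp_id G F) (functor_comp_comp G F).

Record natural_iso (C D : category) (F G : functor C D) := NaturalIso {
  ni_fwd : forall a, Hom (F a) (G a);
  ni_bwd : forall a, Hom (G a) (F a);
  ni_natural : forall a b (f : Hom a b),
    Comp (ni_fwd b) (F_hom F f) = Comp (F_hom G f) (ni_fwd a);
  ni_bwdK : forall a, Comp (ni_fwd a) (ni_bwd a) = Id (G a);
  ni_fwdK : forall a, Comp (ni_bwd a) (ni_fwd a) = Id (F a)
}.

Definition establish_equivalence (C D : category) (F : functor C D)
    (G : functor D C) : Prop :=
  inhabited (natural_iso (functor_id C) (functor_comp G F)) /\
  inhabited (natural_iso (functor_comp F G) (functor_id D)).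

Definition full_subcategory (C : category) (Q : C -> Prop) : category :=
  @Category {a : C | Q a} (fun a b => Hom (proj1_sig a) (proj1_sig b))
    (fun a => Id (proj1_sig a)) (fun a b c g f => Comp g f)
    (fun a b f => Comp_idl f) (fun a b f => Comp_idr f)
    (fun a b c d h g f => CompA h g f).

Definition inclusion (C : category) (Q : C -> Prop) :
    functor (full_subcategory Q) C :=
  @Functor (full_subcategory Q) C (fun a => proj1_sig a) (fun a b f => f)
    (fun a => eq_refl) (fun a b c g f => eq_refl).

Record A_ob (S : restriction_semigroup) := AOb {
  A_X : semilattice;
  A_p : sl_morphism A_X (projections S);
  A_act :> premorphism S (sym_inv A_X);
  A1_dom : forall s, order_ideal (dom (A_act s));
  A1_ran : forall s, order_ideal (ran (A_act s));
  A2 : forall s x x' y y', graph (A_act s) x x' -> graph (A_act s) y y' ->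
    (sl_le x y <-> sl_le x' y');
  A3_sub : forall (e : projections S) x,
    down (fun y => A_p y = e) x -> dom (A_act (pval e)) x;
  A3_sup : forall (e : projections S) x,
    dom (A_act (pval e)) x -> down (fun f => f = e) (A_p x);
  A4 : forall s, exists2 x, dom (A_act s) x & A_p x = pstar s
}.

Record A_hom (S : restriction_semigroup) (a b : A_ob S) := AHom {
  A_fun :> sl_morphism (A_X a) (A_X b);
  M1 : forall x, A_p a x = A_p b (A_fun x);
  M2_dom : forall s x, dom (a s) x -> dom (b s) (A_fun x);
  M2_act : forall s x (hx : dom (a s) x) (hfx : dom (b s) (A_fun x)),
    pb_app hfx = A_fun (pb_app hx)
}.

Lemma A_hom_graph (S : restriction_semigroup) (a b : A_ob S) (f : A_hom a b)
  s x y : graph (a s) x y -> graph (b s) (f x) (f y).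
Proof.
move=> xy; have hx : dom (a s) x by exists y.
have hfx := M2_dom f hx.
rewrite (graph_fun xy (pb_appP hx)) -(@M2_act S a b f s x hx hfx).
exact: pb_appP.
Qed.

Lemma sl_morphism_eq (X Y : semilattice) (f g : sl_morphism X Y) :
  (forall x, f x = g x) -> f = g.
Proof.
case: f g => [f hf] [g hg] /= h.
have fg : f = g by exact: functional_extensionality.
by subst g; rewrite (proof_irrelevance _ hf hg).
Qed.

Lemma A_hom_eq (S : restriction_semigroup) (a b : A_ob S) (f g : A_hom a b) :
  (forall x, f x = g x) -> f = g.
Proof.
case: f g => [f hf1 hf2 hf3] [g hg1 hg2 hg3] /= h.
have fg : f = g by exact: sl_morphism_eq.
subst g; rewrite (proof_irrelevance _ hf1 hg1) (proof_irrelevance _ hf2 hg2).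
by rewrite (proof_irrelevance _ hf3 hg3).
Qed.

Section AHomOfGraph.
Context (S : restriction_semigroup) (a b : A_ob S) (f : sl_morphism (A_X a) (A_X b)).
Context (fp : forall x, A_p a x = A_p b (f x))
  (fgr : forall s x y, graph (a s) x y -> graph (b s) (f x) (f y)).

Lemma graph_M2_dom s x : dom (a s) x -> dom (b s) (f x).
Proof. by move=> [y xy]; exists (f y); apply: fgr. Qed.

Lemma graph_M2_act s x (hx : dom (a s) x) (hfx : dom (b s) (f x)) :
  pb_app hfx = f (pb_app hx).
Proof. by apply: graph_fun (pb_appP hfx) _; apply/fgr/pb_appP. Qed.

Definition A_hom_of_graph : A_hom a b := AHom fp graph_M2_dom graph_M2_act.

End AHomOfGraph.

Definition sl_id (X : semilattice) : sl_morphism X X :=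
  @SlMorphism X X (fun x => x) (fun x y => eq_refl).

Lemma sl_comp_morph (X Y Z : semilattice) (g : sl_morphism Y Z)
  (f : sl_morphism X Y) x y : g (f (meet x y)) = meet (g (f x)) (g (f y)).
Proof. by rewrite !sl_funM. Qed.

Definition sl_comp (X Y Z : semilattice) (g : sl_morphism Y Z)
    (f : sl_morphism X Y) : sl_morphism X Z :=
  @SlMorphism X Z (fun x => g (f x)) (sl_comp_morph g f).


Definition A_id (S : restriction_semigroup) (a : A_ob S) : A_hom a a :=
  A_hom_of_graph (f := sl_id (A_X a)) (fun x => eq_refl) (fun s x y h => h).

Section AComp.
Context (S : restriction_semigroup) (a b c : A_ob S) (g : A_hom b c) (f : A_hom a b).

Lemma A_comp_M1 x : A_p a x = A_p c (sl_comp g f x).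
Proof. by rewrite (M1 f) (M1 g). Qed.

Lemma A_comp_graph s x y :
  graph (a s) x y -> graph (c s) (sl_comp g f x) (sl_comp g f y).
Proof. by move=> h; do 2!apply: A_hom_graph. Qed.

Definition A_comp : A_hom a c := A_hom_of_graph A_comp_M1 A_comp_graph.

End AComp.

Definition catA (S : restriction_semigroup) : category :=
  @Category (A_ob S) (@A_hom S) (@A_id S) (@A_comp S)
    (fun a b f => @A_hom_eq S a b (A_comp (A_id b) f) f (fun x => eq_refl))
    (fun a b f => @A_hom_eq S a b (A_comp f (A_id a)) f (fun x => eq_refl))
    (fun a b c d h g f => @A_hom_eq S a d
       (A_comp h (A_comp g f)) (A_comp (A_comp h g) f) (fun x => eq_refl)).

Definition A3a (S : restriction_semigroup) (a : catA S) : Prop :=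
  forall s y, dom (A_act a s) y <->
    exists2 t, rs_le t s & dom (A_act a t) y /\ A_p a y = pstar t.

Definition catAhat (S : restriction_semigroup) : category :=
  full_subcategory (@A3a S).

Definition Ihat (S : restriction_semigroup) : functor (catAhat S) (catA S) :=
  inclusion (@A3a S).

Record P_ob (S : restriction_semigroup) := POb {
  P_T : restriction_semigroup;
  P_mor :> rs_morphism P_T S;
  P_proper : proper P_mor
}.

Record P_hom (S : restriction_semigroup) (a b : P_ob S) := PHom {
  P_fun :> rs_morphism (P_T a) (P_T b);
  P_comm : forall t, P_mor b (P_fun t) = P_mor a t
}.

Lemma rs_morphism_eq (S T : restriction_semigroup) (f g : rs_morphism S T) :
  (forall x, f x = g x) -> f = g.
Proof.
case: f g => [f f1 f2 f3] [g g1 g2 g3] /= h.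
have fg : f = g by exact: functional_extensionality.
subst g; rewrite (proof_irrelevance _ f1 g1) (proof_irrelevance _ f2 g2).
by rewrite (proof_irrelevance _ f3 g3).
Qed.

Lemma P_hom_eq (S : restriction_semigroup) (a b : P_ob S) (f g : P_hom a b) :
  (forall t, f t = g t) -> f = g.
Proof.
case: f g => [f hf] [g hg] /= h.
have fg : f = g by exact: rs_morphism_eq.
by subst g; rewrite (proof_irrelevance _ hf hg).
Qed.

Definition rs_id (S : restriction_semigroup) : rs_morphism S S :=
  @RsMorphism S S (fun x => x) (fun x y => eq_refl) (fun x => eq_refl)
    (fun x => eq_refl).

Section RsComp.
Context (S T U : restriction_semigroup) (g : rs_morphism T U) (f : rs_morphism S T).

Lemma rs_compM x y : g (f (x * y)) = g (f x) * g (f y).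
Proof. by rewrite !rs_funM. Qed.

Lemma rs_comp_star x : g (f x^*) = (g (f x))^*.
Proof. by rewrite !rs_fun_star. Qed.

Lemma rs_comp_plus x : g (f x^+) = (g (f x))^+.
Proof. by rewrite !rs_fun_plus. Qed.

Definition rs_comp : rs_morphism S U :=
  @RsMorphism S U (fun x => g (f x)) rs_compM rs_comp_star rs_comp_plus.

End RsComp.

Definition P_id (S : restriction_semigroup) (a : P_ob S) : P_hom a a :=
  @PHom S a a (rs_id (P_T a)) (fun t => eq_refl).

Lemma P_comp_comm (S : restriction_semigroup) (a b c : P_ob S)
  (g : P_hom b c) (f : P_hom a b) t : P_mor c (rs_comp g f t) = P_mor a t.
Proof. by rewrite /= !P_comm. Qed.

Definition P_comp (S : restriction_semigroup) (a b c : P_ob S)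
    (g : P_hom b c) (f : P_hom a b) : P_hom a c :=
  PHom (P_comp_comm g f).

Definition catP (S : restriction_semigroup) : category :=
  @Category (P_ob S) (@P_hom S) (@P_id S) (@P_comp S)
    (fun a b f => @P_hom_eq S a b (P_comp (P_id b) f) f (fun x => eq_refl))
    (fun a b f => @P_hom_eq S a b (P_comp f (P_id a)) f (fun x => eq_refl))
    (fun a b c d h g f => @P_hom_eq S a d
       (P_comp h (P_comp g f)) (P_comp (P_comp h g) f) (fun x => eq_refl)).

Section ActionTheory.
Context (S : restriction_semigroup) (a : A_ob S).
Implicit Types (s t : S) (x y z : A_X a).

Lemma act_mul s t x y z : graph (a t) x y -> graph (a s) y z -> graph (a (s * t)) x z.
Proof.
move=> xy yz; have /I_leP := pre_funM a s t; apply.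
by exists y.
Qed.

Lemma act_proj e x y : is_projection e -> graph (a e) x y -> x = y.
Proof.
move=> he xy; have /I_leP h := pre_fun_star a e.
have : graph (a e^*) x x by apply: h; apply/pb_starE; split => //; exists y.
by rewrite projS // => xx; apply: graph_fun xx xy.
Qed.

Lemma act_star s x y : graph (a s) x y -> graph (a s^*) x x.
Proof.
move=> xy; have /I_leP := pre_fun_star a s; apply.
by apply/pb_starE; split => //; exists y.
Qed.

Lemma act_plus s x y : graph (a s) x y -> graph (a s^+) y y.
Proof.
move=> xy; have /I_leP := pre_fun_plus a s; apply.
by apply/pb_plusE; split => //; exists x.
Qed.

Lemma act_p x : graph (a (pval (A_p a x))) x x.
Proof.
have [y xy] : dom (a (pval (A_p a x))) x.
  by apply: A3_sub; exists x => //; apply: sl_le_refl.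
by move: (act_proj (pvalP _) xy) (xy) => <-.
Qed.

Lemma act_le e x y : is_projection e -> graph (a e) x y -> rs_le (pval (A_p a x)) e.
Proof.
move=> he xy.
have [|f -> ] := @A3_sup S a (Projection he) x; first by exists y.
by move/sl_le_pval.
Qed.

(* The values of [p] at the two ends of an arrow of the action determine each
   other. *)
Lemma act_p_ran s x y : graph (a s) x y ->
  pval (A_p a y) = (s * pval (A_p a x))^+.
Proof.
move=> xy; set f := pval (A_p a x); set g := pval (A_p a y).
have hf : is_projection f by apply: pvalP.
have hg : is_projection g by apply: pvalP.
have le1 : rs_le g (s * f)^+.
  apply: act_le (is_projection_plus _) _.
  exact: act_plus (act_mul (act_p x) xy).
have le2 : rs_le f (g * s)^*.
  apply: act_le (is_projection_star _) _.
  exact: act_star (act_mul xy (act_p y)).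
have le3 : rs_le (s * f)^+ g.
  apply: (@rs_le_trans _ (g * s)^+); last first.
    rewrite plus_projM //; apply: rs_le_mulr; exact: is_projection_plus.
  apply: rs_le_plusM; rewrite (proj_mul s hg).
  by apply: rs_leM => //; apply: rs_le_refl.
have hsf : is_projection (s * f)^+ by apply: is_projection_plus.
move/rs_le_plus: le1; move/rs_le_plus: le3.
rewrite (projP hg) (projP hsf) => e1 e2.
by rewrite e2 projC.
Qed.

Lemma act_p_dom s x y : graph (a s) x y ->
  pval (A_p a x) = (pval (A_p a y) * s)^*.
Proof.
move=> xy; rewrite (act_p_ran xy); set f := pval _.
have hf : is_projection f by apply: pvalP.
have le2 : rs_le f s^*.
  exact: act_le (is_projection_star _) (act_star xy).
rewrite -mul_proj // star_projM //.
by move/rs_le_plus: le2; rewrite projP // => {1}->; rewrite projC //; apply: is_projection_star.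
Qed.

Lemma act_meet s x y x' y' : graph (a s) x x' -> graph (a s) y y' ->
  graph (a s) (meet x y) (meet x' y').
Proof.
move=> xx yy.
have [z xyz] : dom (a s) (meet x y).
  by apply: (@A1_dom S a s _ x); [exists x' | apply: meet_lel].
have [w wxy] : ran (a s) (meet x' y').
  by apply: (@A1_ran S a s _ x'); [exists x | apply: meet_lel].
have -> : meet x' y' = z; last exact: xyz.
apply: sl_le_anti; last first.
  by apply: le_meet;
    [apply/(A2 xyz xx); apply: meet_lel | apply/(A2 xyz yy); apply: meet_ler].
apply/(A2 wxy xyz); apply: le_meet.
  by apply/(A2 wxy xx); apply: meet_lel.
by apply/(A2 wxy yy); apply: meet_ler.
Qed.

End ActionTheory.

Record pap (S : restriction_semigroup) (a : A_ob S) := Pap {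
  pt : A_X a;
  lab : S;
  pap_ran : ran (a lab) pt;
  pap_p : A_p a pt = pplus lab
}.

Lemma pap_eq (S : restriction_semigroup) (a : A_ob S) (u v : pap a) :
  pt u = pt v -> lab u = lab v -> u = v.
Proof.
case: u v => [x s h1 h2] [y t h3 h4] /= e1 e2; subst y t.
by rewrite (proof_irrelevance _ h1 h3) (proof_irrelevance _ h2 h4).
Qed.

Section PartialActionProduct.
Context (S : restriction_semigroup) (a : A_ob S).
Implicit Types u v w : pap a.

(* For u = (x, s), the element alpha_s^{-1}(x). *)
Definition lo u : A_X a := @pb_app _ (pb_inv (a (lab u))) (pt u) (pap_ran u).

Lemma loP u : graph (a (lab u)) (lo u) (pt u).
Proof. exact: (@pb_appP _ (pb_inv (a (lab u)))). Qed.

Lemma loE u x : graph (a (lab u)) x (pt u) -> lo u = x.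
Proof. by move=> h; apply: graph_inj (loP u) h. Qed.

Lemma p_lo u : A_p a (lo u) = pstar (lab u).
Proof.
apply: pval_inj; rewrite (act_p_dom (loP u)) pap_p /=.
by rewrite rs_plus_mul.
Qed.

Lemma pap_mul_dom u v : dom (a (lab u)) (meet (lo u) (pt v)).
Proof.
apply: (@A1_dom S a _ _ (lo u)); last exact: meet_lel.
by exists (pt u); apply: loP.
Qed.

Definition pap_mul_pt u v : A_X a := pb_app (pap_mul_dom u v).

Lemma pap_mul_ptP u v : graph (a (lab u)) (meet (lo u) (pt v)) (pap_mul_pt u v).
Proof. exact: pb_appP. Qed.

Lemma pap_mul_lo u v : exists2 w,
  graph (a (lab v)) w (meet (lo u) (pt v)) &
  graph (a (lab u * lab v)) w (pap_mul_pt u v).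
Proof.
have [|w h] := @A1_ran S a (lab v) (meet (lo u) (pt v)) (pt v) (pap_ran v).
  exact: meet_ler.
by exists w => //; apply: act_mul h (pap_mul_ptP u v).
Qed.

Lemma pap_mul_ran u v : ran (a (lab u * lab v)) (pap_mul_pt u v).
Proof. by have [w _ h] := pap_mul_lo u v; exists w. Qed.

Lemma pap_mul_p u v : A_p a (pap_mul_pt u v) = pplus (lab u * lab v).
Proof.
apply: pval_inj; rewrite (act_p_ran (pap_mul_ptP u v)) sl_funM p_lo pap_p /=.
by rewrite rs_mulA rs_mul_star plus_mul_plus.
Qed.

Definition pap_mul u v : pap a := Pap (pap_mul_ran u v) (pap_mul_p u v).

Lemma pap_star_ran u : ran (a (lab u)^*) (lo u).
Proof. by exists (lo u); apply: act_star (loP u). Qed.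

Lemma pap_star_p u : A_p a (lo u) = pplus (lab u)^*.
Proof. by rewrite p_lo; apply: pval_inj; rewrite /= rs_plus_star. Qed.

Definition pap_star u : pap a := Pap (pap_star_ran u) (pap_star_p u).

Lemma pap_plus_ran u : ran (a (lab u)^+) (pt u).
Proof. by exists (pt u); apply: act_plus (loP u). Qed.

Lemma pap_plus_p u : A_p a (pt u) = pplus (lab u)^+.
Proof.
by rewrite pap_p; apply: pval_inj; rewrite /= (projP (is_projection_plus _)).
Qed.

Definition pap_plus u : pap a := Pap (pap_plus_ran u) (pap_plus_p u).

Lemma pap_mulE u v x :
  graph (a (lab u)) (meet (lo u) (pt v)) x -> pt (pap_mul u v) = x.
Proof. by move=> h; apply: graph_fun (pap_mul_ptP u v) h. Qed.

Lemma lo_proj u : is_projection (lab u) -> lo u = pt u.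
Proof. by move=> he; apply: act_proj he (loP u). Qed.

Lemma lo_star u : lo (pap_star u) = lo u.
Proof. by apply: lo_proj; apply: is_projection_star. Qed.

Lemma lo_plus u : lo (pap_plus u) = pt u.
Proof. by apply: lo_proj; apply: is_projection_plus. Qed.

Lemma pt_proj_mul u v : is_projection (lab u) ->
  pt (pap_mul u v) = meet (pt u) (pt v).
Proof.
by move=> he; rewrite /= -(act_proj he (pap_mul_ptP u v)) lo_proj.
Qed.

Lemma pt_mul_le u v : sl_le (pt (pap_mul u v)) (pt u).
Proof. by apply/(A2 (pap_mul_ptP u v) (loP u)); apply: meet_lel. Qed.

Lemma pap_mulA u v w : pap_mul u (pap_mul v w) = pap_mul (pap_mul u v) w.
Proof.
apply: pap_eq; last exact: rs_mulA.
have [k kv kuv] := pap_mul_lo u v.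
have lok : lo (pap_mul u v) = k by apply: loE.
have h1 : graph (a (lab v)) (meet k (pt w)) (meet (lo u) (pt (pap_mul v w))).
  have -> : meet k (pt w) = meet k (meet (lo v) (pt w)).
    have lek : sl_le k (lo v) by apply/(A2 kv (loP v)); apply: meet_ler.
    by rewrite meetA -lek.
  have -> : meet (lo u) (pt (pap_mul v w)) =
            meet (meet (lo u) (pt v)) (pt (pap_mul v w)).
    by rewrite -meetA (meetC (pt v)) -pt_mul_le.
  exact: act_meet kv (pap_mul_ptP v w).
apply: pap_mulE.
have [z hz] : dom (a (lab u)) (meet (lo u) (pt (pap_mul v w))).
  exact: pap_mul_dom.
rewrite (@pap_mulE (pap_mul u v) w z) //.
by rewrite lok; apply: act_mul h1 hz.
Qed.

Lemma pap_plus_mul u : pap_mul (pap_plus u) u = u.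
Proof.
apply: pap_eq; last exact: rs_plus_mul.
rewrite pt_proj_mul; last exact: is_projection_plus.
exact: meetI.
Qed.

Lemma pap_plusC u v :
  pap_mul (pap_plus u) (pap_plus v) = pap_mul (pap_plus v) (pap_plus u).
Proof.
apply: pap_eq; last exact: rs_plusC.
by rewrite !pt_proj_mul; try exact: is_projection_plus; exact: meetC.
Qed.

Lemma pap_plusM u v :
  pap_plus (pap_mul (pap_plus u) v) = pap_mul (pap_plus u) (pap_plus v).
Proof.
apply: pap_eq; last exact: rs_plusM.
have hu : is_projection (lab (pap_plus u)) by apply: is_projection_plus.
rewrite (pt_proj_mul (pap_plus v) hu).
exact: (pt_proj_mul v hu).
Qed.

Lemma pap_plus_ample u v :
  pap_mul (pap_plus (pap_mul u v)) u = pap_mul u (pap_plus v).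
Proof.
apply: pap_eq; last exact: rs_plus_ample.
rewrite pt_proj_mul; last exact: is_projection_plus.
rewrite (@pap_mulE u (pap_plus v) (pt (pap_mul u v))); last exact: (pap_mul_ptP u v).
by rewrite -[pt (pap_plus _)]/(pt (pap_mul u v)) -pt_mul_le.
Qed.

Lemma pap_mul_star u : pap_mul u (pap_star u) = u.
Proof.
apply: pap_eq; last exact: rs_mul_star.
by apply: pap_mulE; rewrite /= meetI; apply: loP.
Qed.

Lemma pap_starC u v :
  pap_mul (pap_star u) (pap_star v) = pap_mul (pap_star v) (pap_star u).
Proof.
apply: pap_eq; last exact: rs_starC.
by rewrite !pt_proj_mul; try exact: is_projection_star; exact: meetC.
Qed.

Lemma pap_starM u v :
  pap_star (pap_mul u (pap_star v)) = pap_mul (pap_star u) (pap_star v).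
Proof.
apply: pap_eq; last exact: rs_starM.
rewrite pt_proj_mul; last exact: is_projection_star.
have [k kv kuv] := pap_mul_lo u (pap_star v).
rewrite -[pt _ in LHS]/(lo (pap_mul u (pap_star v))) (@loE _ k) //.
exact: act_proj (is_projection_star _) kv.
Qed.

Lemma pap_star_ample u v :
  pap_mul v (pap_star (pap_mul u v)) = pap_mul (pap_star u) v.
Proof.
apply: pap_eq; last exact: rs_star_ample.
rewrite (@pt_proj_mul (pap_star u) v); last exact: is_projection_star.
have [k kv kuv] := pap_mul_lo u v.
have lok : pt (pap_star (pap_mul u v)) = k by apply: (@loE (pap_mul u v)).
have lek : sl_le k (lo v) by apply/(A2 kv (loP v)); apply: meet_ler.
by apply: pap_mulE; rewrite lok meetC -lek.
Qed.

Lemma pap_star_plus u : pap_star (pap_plus u) = pap_plus u.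
Proof. by apply: pap_eq; [exact: lo_plus | exact: rs_star_plus]. Qed.

Lemma pap_plus_star u : pap_plus (pap_star u) = pap_star u.
Proof. by apply: pap_eq; [ | exact: rs_plus_star]. Qed.

Definition partial_action_product : restriction_semigroup :=
  @RestrictionSemigroup (pap a) pap_mul pap_star pap_plus
    pap_mulA pap_plus_mul pap_plusC pap_plusM pap_plus_ample
    pap_mul_star pap_starC pap_starM pap_star_ample
    pap_star_plus pap_plus_star.

Definition pap_lab : rs_morphism partial_action_product S :=
  @RsMorphism partial_action_product S (fun u : pap a => lab u)
    (fun u v => eq_refl) (fun u => eq_refl) (fun u => eq_refl).

Lemma pap_lab_proper : proper pap_lab.
Proof.
split=> [s|u v /= uv].
  have [x [y xy] px] := @A4 S a s.
  have hp : A_p a y = pplus s.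
    by apply: pval_inj; rewrite (act_p_ran xy) px /= rs_mul_star.
  by exists (@Pap S a y s (ex_intro _ x xy) hp).
have e1 : lab u * (lab v)^* = lab v * (lab u)^* by rewrite uv.
have e2 : (lab v)^+ * lab u = (lab u)^+ * lab v by rewrite uv.
split; apply: pap_eq => //.
  apply: pap_mulE; rewrite uv meetC.
  exact: (pap_mul_ptP v (pap_star u)).
rewrite !pt_proj_mul; try exact: is_projection_plus.
exact: meetC.
Qed.

Definition U_ob : P_ob S := POb pap_lab_proper.

End PartialActionProduct.

Section UHom.
Context (S : restriction_semigroup) (a b : A_ob S) (f : A_hom a b).
Implicit Types u v : pap a.

Lemma U_fun_ran u : ran (b (lab u)) (f (pt u)).
Proof. by exists (f (lo u)); apply: A_hom_graph; apply: loP. Qed.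

Lemma U_fun_p u : A_p b (f (pt u)) = pplus (lab u).
Proof. by rewrite -M1 pap_p. Qed.

Definition U_fun u : pap b := Pap (U_fun_ran u) (U_fun_p u).

Lemma lo_U_fun u : lo (U_fun u) = f (lo u).
Proof. by apply: loE; apply: A_hom_graph; apply: loP. Qed.

Lemma U_funM u v : U_fun (pap_mul u v) = pap_mul (U_fun u) (U_fun v).
Proof.
apply: pap_eq => //; symmetry; apply: pap_mulE.
by rewrite lo_U_fun -sl_funM; apply: A_hom_graph; apply: pap_mul_ptP.
Qed.

Lemma U_fun_star u : U_fun (pap_star u) = pap_star (U_fun u).
Proof. by apply: pap_eq => //=; rewrite lo_U_fun. Qed.

Lemma U_fun_plus u : U_fun (pap_plus u) = pap_plus (U_fun u).
Proof. exact: pap_eq. Qed.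

Definition U_hom : P_hom (U_ob a) (U_ob b) :=
  @PHom S (U_ob a) (U_ob b)
    (@RsMorphism (partial_action_product a) (partial_action_product b)
       U_fun U_funM U_fun_star U_fun_plus)
    (fun u => eq_refl).

End UHom.

Lemma U_id (S : restriction_semigroup) (a : catA S) : U_hom (Id a) = P_id (U_ob a).
Proof. by apply: P_hom_eq => u; apply: pap_eq. Qed.

Lemma U_comp (S : restriction_semigroup) (a b c : catA S)
  (g : Hom b c) (f : Hom a b) :
  U_hom (Comp g f) = P_comp (U_hom g) (U_hom f).
Proof. by apply: P_hom_eq => u; apply: pap_eq. Qed.

Definition U (S : restriction_semigroup) : functor (catA S) (catP S) :=
  @Functor (catA S) (catP S) (@U_ob S) (@U_hom S) (@U_id S) (@U_comp S).

Definition Uhat (S : restriction_semigroup) : functor (catAhat S) (catP S) :=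
  functor_comp (U S) (Ihat S).

Section GOb.
Context (S : restriction_semigroup) (a : P_ob S).
Notation T := (P_T a).
Notation psi := (P_mor a).
Implicit Types (s : S) (t : T) (e f : projections T).

(* The value (te)^+ does not depend on the choice of t: see [psihat_fun]. *)
Definition psihat_graph s e f : Prop :=
  exists t, [/\ rs_le (psi t) s, sl_le e (pstar t) & f = pplus (t * pval e)].

Lemma psihat_graphP s e f : psihat_graph s e f <->
  exists t, [/\ rs_le (psi t) s, t^* = pval e & t^+ = pval f].
Proof.
split=> [[t [ts et ->]]|[t [ts et tf]]].
  have he := pvalP e; exists (t * pval e); split => //.
    by apply: rs_le_trans ts; apply: rs_fun_le; apply: rs_le_mulr.
  rewrite star_projM //.
  by move/(f_equal (@pval T)): et => /= {2}->; rewrite projC //; apply: is_projection_star.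
exists t; split => //.
  have -> : pstar t = e by apply: pval_inj.
  exact: sl_le_refl.
by apply: pval_inj; rewrite /= -et rs_mul_star.
Qed.

(* An element t with psi(t) <= s is determined by t^* (resp. t^+). *)
Lemma psi_star_inj s t1 t2 : rs_le (psi t1) s -> rs_le (psi t2) s ->
  t1^* = t2^* -> t1 = t2.
Proof.
move=> /rs_le_star h1 /rs_le_star h2 e.
have e' : psi t1 = psi t2 by rewrite h1 h2 -!rs_fun_star e.
have [h _] := proj2 (P_proper a) _ _ e'.
by move: h; rewrite -e rs_mul_star e rs_mul_star.
Qed.

Lemma psi_plus_inj s t1 t2 : rs_le (psi t1) s -> rs_le (psi t2) s ->
  t1^+ = t2^+ -> t1 = t2.
Proof.
move=> /rs_le_plus h1 /rs_le_plus h2 e.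
have e' : psi t1 = psi t2 by rewrite h1 h2 -!rs_fun_plus e.
have [_ h] := proj2 (P_proper a) _ _ e'.
by move: h; rewrite -e rs_plus_mul e rs_plus_mul.
Qed.

Lemma psihat_fun s e f g : psihat_graph s e f -> psihat_graph s e g -> f = g.
Proof.
move=> /psihat_graphP [t1 [h1 e1 f1]] /psihat_graphP [t2 [h2 e2 f2]].
apply: pval_inj; rewrite -f1 -f2; congr (_^+).
by apply: psi_star_inj h1 h2 _; rewrite e1.
Qed.

Lemma psihat_inj s e f g : psihat_graph s e g -> psihat_graph s f g -> e = f.
Proof.
move=> /psihat_graphP [t1 [h1 e1 f1]] /psihat_graphP [t2 [h2 e2 f2]].
apply: pval_inj; rewrite -e1 -e2; congr (_^*).
by apply: psi_plus_inj h1 h2 _; rewrite f1.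
Qed.

Definition psihat s : sym_inv (projections T) := PBij (@psihat_fun s) (@psihat_inj s).

Lemma psihat_domP s e : dom (psihat s) e <->
  exists2 t, sl_le e (pstar t) & rs_le (psi t) s.
Proof.
split; first by case=> f [t [h1 h2 _]]; exists t.
by case=> t h1 h2; exists (pplus (t * pval e)); exists t.
Qed.

Lemma psihatP s e f : graph (psihat s) e f <->
  exists t, [/\ rs_le (psi t) s, t^* = pval e & t^+ = pval f].
Proof. exact: psihat_graphP. Qed.

Lemma psihat_mul s s' : rs_le (psihat s * psihat s') (psihat (s * s')).
Proof.
apply/I_leP => e f [g /psihatP [t1 [h1 e1 g1]] /psihatP [t2 [h2 g2 f2]]].
apply/psihatP; exists (t2 * t1); split.
- by rewrite rs_funM; apply: rs_leM.
- by rewrite -star_mul_star g2 -g1 rs_plus_mul.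
- by rewrite -plus_mul_plus g1 -g2 rs_mul_star.
Qed.

Lemma psihat_star s : rs_le (psihat s)^* (psihat s^*).
Proof.
apply/I_leP => e f /pb_starE [<- [g /psihatP [t [h et tg]]]].
apply/psihatP; exists t^*; split; last by rewrite rs_plus_star.
  by rewrite rs_fun_star; apply: rs_le_starM.
by rewrite projS //; apply: is_projection_star.
Qed.

Lemma psihat_plus s : rs_le (psihat s)^+ (psihat s^+).
Proof.
apply/I_leP => e f /pb_plusE [<- [g /psihatP [t [h et tg]]]].
apply/psihatP; exists t^+; split; first by rewrite rs_fun_plus; apply: rs_le_plusM.
  by rewrite rs_star_plus.
by rewrite projP //; apply: is_projection_plus.
Qed.

Definition psihat_premorphism : premorphism S (sym_inv (projections T)) :=
  Premorphism psihat_mul psihat_star psihat_plus.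

Lemma psihat_A1_dom s : order_ideal (dom (psihat s)).
Proof.
move=> e f /psihat_domP [t h1 h2] ef; apply/psihat_domP; exists t => //.
exact: sl_le_trans ef h1.
Qed.

Lemma psihat_A1_ran s : order_ideal (ran (psihat s)).
Proof.
move=> e f [g /psihatP [t [h1 h2 h3]]] /sl_le_pval /rs_le_plus ef.
have he := pvalP e.
exists (pstar (pval e * t)); apply/psihatP; exists (pval e * t); split => //.
  by apply: rs_le_trans h1; apply: rs_fun_le; apply: rs_le_mull.
by rewrite plus_projM // h3 {2}ef projP.
Qed.

Lemma psihat_A2 s e e' f f' :
  graph (psihat s) e e' -> graph (psihat s) f f' ->
  (sl_le e f <-> sl_le e' f').
Proof.
move=> /psihatP [t1 [h1 e1 e1']] /psihatP [t2 [h2 e2 e2']].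
split=> /sl_le_pval /rs_le_plus ef; apply/sl_le_pval.
  rewrite -e1' -e2'; apply: rs_le_plusM.
  suff -> : t1 = t2 * pval e by apply: rs_le_mulr; apply: pvalP.
  apply: psi_star_inj h1 _ _.
    by apply: rs_le_trans h2; apply: rs_fun_le; apply: rs_le_mulr; apply: pvalP.
  rewrite star_projM; last exact: pvalP.
  by rewrite e1 e2 projC; try exact: pvalP; rewrite {1}ef projP //; apply: pvalP.
rewrite -e1 -e2; apply: rs_le_starM.
suff -> : t1 = pval e' * t2 by apply: rs_le_mull; apply: pvalP.
apply: psi_plus_inj h1 _ _.
  by apply: rs_le_trans h2; apply: rs_fun_le; apply: rs_le_mull; apply: pvalP.
rewrite plus_projM; last exact: pvalP.
by rewrite e1' e2' {1}ef projP //; apply: pvalP.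
Qed.

Lemma psihat_A3_sub (e : projections S) f :
  down (fun g => restrP psi g = e) f -> dom (psihat (pval e)) f.
Proof.
case=> g <- fg; apply/psihat_domP; exists (pval f).
  have -> : pstar (pval f) = f.
    by apply: pval_inj; rewrite /= projS //; apply: pvalP.
  exact: sl_le_refl.
by apply: rs_fun_le; apply/sl_le_pval.
Qed.

Lemma psihat_A3_sup (e : projections S) f :
  dom (psihat (pval e)) f -> down (fun g => g = e) (restrP psi f).
Proof.
case=> g /psihatP [t [h1 h2 h3]]; exists e => //; apply/sl_le_pval.
rewrite /= -h2 rs_fun_star -(projS (pvalP e)).
exact: rs_le_starM.
Qed.

Lemma psihat_A4 s : exists2 e, dom (psihat s) e & restrP psi e = pstar s.
Proof.
have [t <-] := proj1 (P_proper a) s.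
exists (pstar t); last by apply: pval_inj; rewrite /= rs_fun_star.
by apply/psihat_domP; exists t; [apply: sl_le_refl | apply: rs_le_refl].
Qed.

Definition G_ob_A : catA S :=
  @AOb S (projections T) (restrP psi) psihat_premorphism
    psihat_A1_dom psihat_A1_ran psihat_A2 psihat_A3_sub psihat_A3_sup psihat_A4.

Lemma psihat_A3a : A3a G_ob_A.
Proof.
move=> s e; split.
  case=> f /psihatP [t [h1 h2 h3]]; exists (psi t) => //; split.
    by exists f; apply/psihatP; exists t; split => //; apply: rs_le_refl.
  by apply: pval_inj; rewrite /= -h2 rs_fun_star.
case=> s' ss' [/psihat_domP [t h1 h2] _]; apply/psihat_domP; exists t => //.
exact: rs_le_trans h2 ss'.
Qed.

Definition G_ob : catAhat S := exist _ G_ob_A psihat_A3a.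

End GOb.

Section GHom.
Context (S : restriction_semigroup) (a b : P_ob S) (g : P_hom a b).

Lemma G_hom_M1 (e : projections (P_T a)) :
  restrP (P_mor a) e = restrP (P_mor b) (restrP g e).
Proof. by apply: pval_inj; rewrite /= P_comm. Qed.

Lemma G_hom_graph s (e f : projections (P_T a)) :
  graph (psihat a s) e f -> graph (psihat b s) (restrP g e) (restrP g f).
Proof.
move=> /psihatP [t [h1 h2 h3]]; apply/psihatP; exists (g t); split.
- by rewrite P_comm.
- by rewrite /= -h2 rs_fun_star.
- by rewrite /= -h3 rs_fun_plus.
Qed.

Definition G_hom : A_hom (G_ob_A a) (G_ob_A b) :=
  @A_hom_of_graph S (G_ob_A a) (G_ob_A b) (restrP g) G_hom_M1 G_hom_graph.

End GHom.

Lemma G_id (S : restriction_semigroup) (a : catP S) :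
  G_hom (Id a) = A_id (G_ob_A a).
Proof. by apply: A_hom_eq => e; apply: pval_inj. Qed.

Lemma G_comp (S : restriction_semigroup) (a b c : catP S)
  (g : Hom b c) (f : Hom a b) :
  G_hom (Comp g f) = A_comp (G_hom g) (G_hom f).
Proof. by apply: A_hom_eq => e; apply: pval_inj. Qed.

Definition Ghat (S : restriction_semigroup) : functor (catP S) (catAhat S) :=
  @Functor (catP S) (catAhat S) (@G_ob S) (@G_hom S) (@G_id S) (@G_comp S).

(* Main.v *)
From Stdlib Require Import ssreflect ssrbool IndefiniteDescription.
Require Import Defs.

Set Implicit Arguments.
Unset Strict Implicit.
Unset Printing Implicit Defensive.
Set SsrOldRewriteGoalsOrder.

Local Open Scope rs_scope.

(** Both composites are isomorphic to the identity for concrete reasons.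

    A projection of X x| S is a pair (x, e) with e a projection of S, and the
    defining condition p(x) = e^+ = e leaves no choice for e.  Hence
    x |-> (x, p(x)) is a semilattice isomorphism from X onto P(X x| S), with
    inverse the first projection ([proj_pair], [proj_pt]).  It carries an arrow
    alpha_s(x) = y to the arrow of the action rebuilt from X x| S -> S, because
    that arrow is realised by the element (y, s p(x)), whose second component
    lies below s.  The converse is where [A3a] enters: an element (y, t) with
    t <= s gives alpha_t(x) = y with p(x) = t^*, and [A3a] is what puts x in the
    domain of alpha_s; the value alpha_s(x) is then y since t = s p(x).

    An element t of T, for psi : T -> S proper, is determined by the pair
    (t^+, psi(t)), and the pairs that occur are precisely the elements of
    P(T) x| S: such an element (f, s) comes with some t below s with t^+ = f,
    and the condition psi(f) = s^+ forces psi(t) = s.  So t |-> (t^+, psi(t)) is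
    a bijective morphism over S ([encode]); the inverse of a bijective morphism
    is a morphism ([P_hom_inv]), which gives the second isomorphism. *)

Definition natural_iso_sym (C D : category) (F G : functor C D)
    (n : natural_iso F G) : natural_iso G F.
Proof.
refine (@NaturalIso C D G F (ni_bwd n) (ni_fwd n) _ (ni_fwdK n) (ni_bwdK n)).
move=> a b f.
rewrite -[F_hom G f]Comp_idr -(ni_bwdK n a) (CompA (F_hom G f)).
by rewrite -(ni_natural n f) !CompA ni_fwdK Comp_idl.
Defined.

(** * The semilattice of a partial action, recovered as projections *)

Section ProjectionsOfProduct.
Context (S : restriction_semigroup) (a : A_ob S).
Implicit Types (x y : A_X a) (s : S).

Lemma pair_ran x : ran (a (pval (A_p a x))) x.
Proof. by exists x; apply: act_p. Qed.

Lemma pair_p x : A_p a x = pplus (pval (A_p a x)).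
Proof. by apply: pval_inj; rewrite /= projP //; apply: pvalP. Qed.

Definition pair x : partial_action_product a := Pap (pair_ran x) (pair_p x).

Lemma pair_proj x : is_projection (pair x).
Proof.
apply/is_projectionP; exists (pair x); apply: pap_eq => //=.
by rewrite projP //; apply: pvalP.
Qed.

Definition proj_pair_fun x : projections (partial_action_product a) :=
  Projection (pair_proj x).

Lemma proj_pairM x y :
  proj_pair_fun (meet x y) = meet (proj_pair_fun x) (proj_pair_fun y).
Proof.
apply: pval_inj; apply: pap_eq; last by rewrite /= sl_funM.
by symmetry; apply: (@pt_proj_mul S a (pair x) (pair y)); apply: pvalP.
Qed.

Definition proj_pair_sl : sl_morphism (A_X a) (projections (partial_action_product a)) :=
  SlMorphism proj_pairM.

Lemma proj_pair_M1 x : A_p a x = restrP (pap_lab a) (proj_pair_sl x).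
Proof. exact: pval_inj. Qed.

(** The arrow x -> y of alpha_s is realised by the element (y, s p(x)): the
    label s itself may be too large, as p(y) can be strictly below s^+. *)
Lemma proj_pair_graph s x y : graph (a s) x y ->
  graph (psihat (U_ob a) s) (proj_pair_sl x) (proj_pair_sl y).
Proof.
move=> xy; set e := pval (A_p a x).
have he : is_projection e by apply: pvalP.
have gy : graph (a (s * e)) x y by apply: act_mul (act_p x) xy.
have py : A_p a y = pplus (s * e) by apply: pval_inj; apply: act_p_ran.
pose t : pap a := Pap (ex_intro _ x gy) py.
have lot : lo t = x by apply: (@loE _ _ t).
apply/psihatP; exists t; split; first exact: rs_le_mulr.
- apply: pap_eq => //=; rewrite -/e star_projM // projC //.
    (* p(x) <= s^* since x lies in the domain of alpha at s^* *)
    have /rs_le_plus : rs_le e s^* by apply: act_le (act_star xy); apply: is_projection_star.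
    by rewrite projP.
  exact: is_projection_star.
- by apply: pap_eq => //=; rewrite py.
Qed.

Definition proj_pair : A_hom a (G_ob_A (U_ob a)) :=
  @A_hom_of_graph S a (G_ob_A (U_ob a)) proj_pair_sl proj_pair_M1 proj_pair_graph.

Lemma projection_lab (e : projections (partial_action_product a)) :
  is_projection (lab (pval e)).
Proof. exact: (is_projection_fun (pap_lab a) (pvalP e)). Qed.

Lemma proj_pt_M (e f : projections (partial_action_product a)) :
  pt (pval (meet e f)) = meet (pt (pval e)) (pt (pval f)).
Proof. exact: pt_proj_mul (projection_lab e). Qed.

Definition proj_pt_sl : sl_morphism (projections (partial_action_product a)) (A_X a) :=
  SlMorphism proj_pt_M.

Lemma proj_pt_M1 e : restrP (pap_lab a) e = A_p a (proj_pt_sl e).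
Proof.
apply: pval_inj; rewrite /= pap_p /= projP //; exact: projection_lab.
Qed.

(** Without [A3a] the arrow lo(t) -> pt(t) would only be known to exist at the
    label of t; [A3a] extends it to every larger s, and the two values agree
    because s p(lo(t)) is the label of t. *)
Lemma proj_pt_graph (ha : A3a a) s e f :
  graph (psihat (U_ob a) s) e f -> graph (a s) (proj_pt_sl e) (proj_pt_sl f).
Proof.
move=> /psihatP [t [ts te tf]].
have -> : proj_pt_sl e = lo t by rewrite /= -te.
have -> : proj_pt_sl f = pt t by rewrite /= -tf.
have [z xz] : dom (a s) (lo t).
  apply/ha; exists (lab t) => //; split; last exact: p_lo.
  by exists (pt t); apply: loP.
suff -> : pt t = z by [].
apply: graph_fun (loP t) _.
have -> : lab t = s * pval (A_p a (lo t)) by rewrite p_lo; apply/rs_le_star.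
exact: act_mul (act_p _) xz.
Qed.

Definition proj_pt (ha : A3a a) : A_hom (G_ob_A (U_ob a)) a :=
  @A_hom_of_graph S (G_ob_A (U_ob a)) a proj_pt_sl proj_pt_M1 (proj_pt_graph ha).

Lemma proj_ptK (ha : A3a a) : A_comp proj_pair (proj_pt ha) = A_id _.
Proof.
apply: A_hom_eq => e; apply: pval_inj; apply: pap_eq => //=.
by rewrite pap_p /= projP //; apply: projection_lab.
Qed.

Lemma proj_pairK (ha : A3a a) : A_comp (proj_pt ha) proj_pair = A_id _.
Proof. exact: A_hom_eq. Qed.

End ProjectionsOfProduct.

Lemma proj_pair_natural (S : restriction_semigroup) (a b : A_ob S) (f : A_hom a b) :
  A_comp (proj_pair b) f = A_comp (G_hom (U_hom f)) (proj_pair a).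
Proof.
by apply: A_hom_eq => x; apply: pval_inj; apply: pap_eq => //=; rewrite (M1 f).
Qed.

Definition unit_iso (S : restriction_semigroup) :
    natural_iso (functor_id (catAhat S)) (functor_comp (Ghat S) (Uhat S)) :=
  @NaturalIso (catAhat S) (catAhat S) (functor_id (catAhat S))
    (functor_comp (Ghat S) (Uhat S))
    (fun a => proj_pair (proj1_sig a)) (fun a => proj_pt (proj2_sig a))
    (fun a b f => proj_pair_natural f)
    (fun a => proj_ptK (proj2_sig a)) (fun a => proj_pairK (proj2_sig a)).

(** * Bijective morphisms over S are isomorphisms *)

Section InverseMorphism.
Context (S : restriction_semigroup) (a b : P_ob S) (g : P_hom a b).
Context (g_inj : forall t u, g t = g u -> t = u) (g_surj : forall v, exists t, g t = v).

Definition inv_fun v := proj1_sig (constructive_indefinite_description _ (g_surj v)).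

Lemma inv_funK v : g (inv_fun v) = v.
Proof. exact: proj2_sig (constructive_indefinite_description _ (g_surj v)). Qed.

Lemma inv_funM v w : inv_fun (v * w) = inv_fun v * inv_fun w.
Proof. by apply: g_inj; rewrite rs_funM !inv_funK. Qed.

Lemma inv_fun_star v : inv_fun v^* = (inv_fun v)^*.
Proof. by apply: g_inj; rewrite rs_fun_star !inv_funK. Qed.

Lemma inv_fun_plus v : inv_fun v^+ = (inv_fun v)^+.
Proof. by apply: g_inj; rewrite rs_fun_plus !inv_funK. Qed.

Lemma inv_fun_comm v : P_mor a (inv_fun v) = P_mor b v.
Proof. by rewrite -(P_comm g) inv_funK. Qed.

Definition P_hom_inv : P_hom b a :=
  @PHom S b a (RsMorphism inv_funM inv_fun_star inv_fun_plus) inv_fun_comm.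

Lemma P_hom_invK : P_comp g P_hom_inv = P_id b.
Proof. by apply: P_hom_eq => v; apply: inv_funK. Qed.

Lemma P_homK : P_comp P_hom_inv g = P_id a.
Proof. by apply: P_hom_eq => t; apply: g_inj; apply: inv_funK. Qed.

End InverseMorphism.

(** * A proper morphism, recovered from its partial action *)

Section Encode.
Context (S : restriction_semigroup) (a : P_ob S).
Notation T := (P_T a).
Notation psi := (P_mor a).
Implicit Types t u : T.

Lemma psihat_ends t : graph (psihat a (psi t)) (pstar t) (pplus t).
Proof. by apply/psihatP; exists t; split => //; apply: rs_le_refl. Qed.

Lemma encode_ran t : ran (psihat a (psi t)) (pplus t).
Proof. by exists (pstar t); apply: psihat_ends. Qed.

Lemma encode_p t : restrP psi (pplus t) = pplus (psi t).
Proof. by apply: pval_inj; rewrite /= rs_fun_plus. Qed.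

Definition encode_fun t : partial_action_product (G_ob_A a) :=
  @Pap S (G_ob_A a) (pplus t) (psi t) (encode_ran t) (encode_p t).

Lemma lo_encode t : lo (encode_fun t) = pstar t.
Proof. by apply: loE; apply: psihat_ends. Qed.

Lemma encodeM t u : encode_fun (t * u) = encode_fun t * encode_fun u.
Proof.
apply: pap_eq; last exact: rs_funM.
symmetry; apply: pap_mulE; rewrite lo_encode.
exists t; split; [exact: rs_le_refl | exact: meet_lel |].
by apply: pval_inj; rewrite /= rs_mulA rs_mul_star plus_mul_plus.
Qed.

Lemma encode_star t : encode_fun t^* = (encode_fun t)^*.
Proof.
apply: pap_eq; last exact: rs_fun_star.
by rewrite [RHS]lo_encode; apply: pval_inj; apply: rs_plus_star.
Qed.

Lemma encode_plus t : encode_fun t^+ = (encode_fun t)^+.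
Proof.
apply: pap_eq; last exact: rs_fun_plus.
by apply: pval_inj; apply: projP; apply: is_projection_plus.
Qed.

Definition encode : P_hom a (U_ob (G_ob_A a)) :=
  @PHom S a (U_ob (G_ob_A a)) (RsMorphism encodeM encode_star encode_plus)
    (fun t => eq_refl).

Lemma encode_inj t u : encode t = encode u -> t = u.
Proof.
move=> tu.
have e1 : psi t = psi u := f_equal (@lab S (G_ob_A a)) tu.
have e2 : t^+ = u^+ := f_equal (@pval T) (f_equal (@pt S (G_ob_A a)) tu).
by apply: (@psi_plus_inj S a (psi t)) => //; [|rewrite e1]; apply: rs_le_refl.
Qed.

(** An arrow of the action of T at s is realised by some t with psi(t) <= s;
    the condition on projections in the product excludes psi(t) < s. *)
Lemma encode_surj v : exists t, encode t = v.
Proof.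
have /psihatP [t [ts _ tv]] := loP v.
have e1 : psi t = lab v.
  (* psi(t) <= s and psi(t)^+ = s^+ leave only psi(t) = s *)
  move/rs_le_plus: ts => ->; rewrite -rs_fun_plus tv.
  by have /(f_equal (@pval S)) /= -> := pap_p v; apply: rs_plus_mul.
by exists t; apply: pap_eq => //; apply: pval_inj.
Qed.

End Encode.

Lemma encode_natural (S : restriction_semigroup) (a b : P_ob S) (g : P_hom a b) :
  P_comp (encode b) g = P_comp (U_hom (G_hom g)) (encode a).
Proof.
apply: P_hom_eq => t; apply: pap_eq => /=; last exact: P_comm.
by apply: pval_inj; rewrite /= rs_fun_plus.
Qed.

Definition encode_iso (S : restriction_semigroup) :
    natural_iso (functor_id (catP S)) (functor_comp (Uhat S) (Ghat S)) :=
  @NaturalIso (catP S) (catP S) (functor_id (catP S))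
    (functor_comp (Uhat S) (Ghat S))
    (@encode S) (fun a => P_hom_inv (@encode_inj S a) (@encode_surj S a))
    (fun a b g => encode_natural g)
    (fun a => P_hom_invK (@encode_inj S a) (@encode_surj S a))
    (fun a => P_homK (@encode_inj S a) (@encode_surj S a)).

Theorem theorem6p9 (S : restriction_semigroup) :
  establish_equivalence (Uhat S) (Ghat S).
Proof.
split; constructor; first exact: unit_iso.
exact: natural_iso_sym (encode_iso S).
Qed.
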